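(* Let $p\ge 1$ and $C_D>0$, and let $(X,d)$ be a metric space such that for every $s,t,x_1,x_2,\dots\in X$, $$\frac{d(s,t)^p}{2^p}+\frac{\inf_{i\ne j}d(x_i,x_j)^p}{C_D^p}\le\max\Big(\sup_i d(s,x_i)^p,\ \sup_i d(t,x_i)^p\Big).$$ Then there exists $C>0$, depending only on $C_D$ and $p$, such that for all sufficiently large $n$, every bi-Lipschitz embedding of the countably branching diamond graph $D_n^\omega$ into $X$ has distortion at least $Cn^{1/p}$.
   Context: Diamond graphs: $D_1^\omega$ is the complete bipartite graph with one side $\{s,t\}$ and the other side $\{x_i\}_{i=1}^\infty$, with directed edges $(s,x_i)$ and $(x_i,t)$ for all $i$. $D_0^\omega$ is a single directed edge from $s$ to $t$. For directed graphs $H,G$ with distinguished vertices $s,t$, the slash product $H\oslash G$ is obtained by replacing each directed edge $(u,v)$ of $H$ by a separate copy of $G$, identifying $s(G)$ with $u$ and $t(G)$ with $v$; one sets $s(H\oslash G)=s(H)$, $t(H\oslash G)=t(H)$. Then $D_{n+1}^\omega=D_n^\omega\oslash D_1^\omega$, i.e. $D_n^\omega=(D_1^\omega)^{\oslash^n}$. $D_n^\omega$ is identified with its vertex set, equipped with the shortest path metric of the underlying undirected unweighted graph. Distortion: for metric spaces $(Y,d_Y)$, $(X,d_X)$ and a map $f:Y\to X$, the distortion of $f$ is the smallest $K\ge 1$ for which there is $\lambda>0$ with $\lambda d_Y(x,y)\le d_X(f(x),f(y))\le K\lambda d_Y(x,y)$ for all $x,y\in Y$; $f$ is bi-Lipschitz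 if such a $K$ exists. *)

(* Defs.v *)
From HB Require Import structures.
From mathcomp Require Import all_boot all_order all_algebra.
From mathcomp Require Import all_classical all_reals all_analysis.

Set Implicit Arguments.
Unset Strict Implicit.
Unset Printing Implicit Defensive.

Import Order.TTheory GRing.Theory Num.Theory.

Local Open Scope classical_set_scope.
Local Open Scope ring_scope.

Record stdigraph := STDigraph {
  vertex : eqType;
  edge : eqType;
  src : edge -> vertex;
  tgt : edge -> vertex;
  gs : vertex;
  gt : vertex;
  gs_neq_gt : gs != gt
}.

Section Slash.
Variables H G : stdigraph.

(* The vertices of G that are not identified with a vertex of H. *)
Definition inner_vertex : eqType :=
  {v : vertex G | (v != gs G) && (v != gt G)}.

Definition slash_vertex : eqType := (vertex H + edge H * inner_vertex)%type.

(* The image of the vertex v in the copy of G that replaces the edge e of H. *)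
Definition slash_copy (e : edge H) (v : vertex G) : slash_vertex :=
  match insub v : option inner_vertex with
  | Some w => inr (e, w)
  | None => inl (if v == gs G then src e else tgt e)
  end.

Definition slash : stdigraph :=
  @STDigraph slash_vertex (edge H * edge G)%type
    (fun ef => slash_copy ef.1 (src ef.2))
    (fun ef => slash_copy ef.1 (tgt ef.2))
    (inl (gs H)) (inl (gt H)) (gs_neq_gt H).

End Slash.

(* A single edge from s = false to t = true. *)
Definition diamond0 : stdigraph :=
  @STDigraph bool unit (fun=> false) (fun=> true) false true isT.

(* The vertices are s = inl false, t = inl true and x_i = inr i; the edges are
   (i, false) = (s, x_i) and (i, true) = (x_i, t). *)
Definition diamond1 : stdigraph :=
  @STDigraph (bool + nat)%type (nat * bool)%type
    (fun e => if e.2 then inr e.1 else inl false)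
    (fun e => if e.2 then inl true else inr e.1)
    (inl false) (inl true) isT.

(* [diamond 1] is [slash diamond0 diamond1], an isomorphic copy of [diamond1]. *)
Fixpoint diamond (n : nat) : stdigraph :=
  if n is m.+1 then slash (diamond m) diamond1 else diamond0.

Definition graph_adjacent (G : stdigraph) (u v : vertex G) : Prop :=
  exists e : edge G, (src e = u /\ tgt e = v) \/ (src e = v /\ tgt e = u).

Definition walk (G : stdigraph) (u v : vertex G) (k : nat) : Prop :=
  exists w : nat -> vertex G,
    [/\ w 0%N = u, w k = v & forall i, (i < k)%N -> graph_adjacent (w i) (w i.+1)].

(* Meaningful for connected graphs, which all the [diamond n] are. *)
Definition graph_dist (R : realType) (G : stdigraph) (u v : vertex G) : R :=
  inf [set k%:R | k in walk u v].

Section Distortion.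
Variables (R : realType) (Y X : Type) (dY : Y -> Y -> R) (dX : X -> X -> R).
Variable f : Y -> X.

Definition distortion_bound (K : R) : Prop :=
  1 <= K /\ exists2 lam : R, 0 < lam &
    forall x y, lam * dY x y <= dX (f x) (f y) <= K * lam * dY x y.

Definition bilipschitz : Prop := exists K : R, distortion_bound K.

(* Only meaningful for bi-Lipschitz maps. *)
Definition distortion : R := inf [set K | distortion_bound K].

End Distortion.

(* The suprema may be infinite, hence the extended reals. *)
Definition diamond_inequality (R : realType) (X : metricType R) (p CD : R) :=
  forall (s t : X) (x : nat -> X),
    ((mdist s t `^ p / 2 `^ p)%:E +
     ereal_inf [set (mdist (x ij.1) (x ij.2) `^ p)%:E
               | ij in [set ij : nat * nat | ij.1 <> ij.2]]
       * ((CD `^ p)^-1)%:E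
     <= maxe (ereal_sup [set (mdist s (x i) `^ p)%:E | i in [set: nat]])
             (ereal_sup [set (mdist t (x i) `^ p)%:E | i in [set: nat]]))%E.

(* Main.v *)
Require Import Defs.
From mathcomp Require Import all_boot all_order all_algebra.
From mathcomp Require Import all_classical all_reals all_analysis.
From mathcomp Require Import lra.

Set Implicit Arguments.
Unset Strict Implicit.
Unset Printing Implicit Defensive.

Import Order.TTheory GRing.Theory Num.Theory.

Local Open Scope classical_set_scope.
Local Open Scope ring_scope.

(** Let [f] embed [diamond n] with lower Lipschitz constant [a] and upper one
    [K * a].  In [diamond m.+1], every edge [(s, t)] of [diamond m] has been
    replaced by a diamond with midpoints [x_i] that are 2-separated, so the
    hypothesis on the target space, applied to the images of [s], [t] and the
    [x_i], says that the stretch of [f] along [(s, t)] is strictly smaller than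
    along the edges of [diamond m.+1]: if [M] bounds the [p]-th powers of the
    lengths of the images of the latter, then the length of the image of
    [(s, t)] satisfies
      [d `^ p <= 2 `^ p * (M - (2 * a / CD) `^ p)].
    Restricting [f] to [diamond m] thus trades the pair [(a, M)] for
    [(2 * a, 2 `^ p * (M - (2 * a / CD) `^ p))], since the metric of
    [diamond m.+1] is twice that of [diamond m] on old vertices.  After [n]
    such steps only [diamond 0] is left and its single edge has an image of
    nonnegative length, whence [n * (2 * a / CD) `^ p <= M]
    ([diamond_edge_image_bound]).  With [M = (K * a) `^ p] this reads
    [2 / CD * n `^ p^-1 <= K]; so [C = 2 / CD] works.

    Apart from the ends of an edge being at distance at most 1, only lower
    bounds on graph distances are needed, and they are all certified by real
    functions that vary by at most 1 along each edge ([edge_lipschitz]): such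
    a function on [G] extends, doubled, to the graph [slash G diamond1]
    ([slash_lift_lipschitz]), and this takes the place of computing the metric
    of the slash product. *)

(** * Lower bounds on graph distances *)

(** [graph_dist] is the infimum of a set of walk lengths, which is 0 when the
    set is empty: lower bounds on it hold for joined vertices only. *)
Definition joined (G : stdigraph) (u v : vertex G) : Prop :=
  exists k, walk u v k.

Definition edge_lipschitz (R : realType) (G : stdigraph) (h : vertex G -> R) :=
  forall e : edge G, `|h (src e) - h (tgt e)| <= 1.

Lemma joined_refl (G : stdigraph) (u : vertex G) : joined u u.
Proof. by exists 0%N, (fun=> u). Qed.

Lemma joined_adjacent (G : stdigraph) (u v w : vertex G) :
  joined u v -> graph_adjacent v w -> joined u w.
Proof.
move=> [k [c [c0 ck cS]]] vw.
exists k.+1, (fun i => if (i <= k)%N then c i else w); split => //.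
  by rewrite ltnn.
move=> i; rewrite ltnS => /[dup] ik; rewrite {1}leq_eqVlt => /predU1P[->|{}ik].
  by rewrite leqnn ltnn ck.
by rewrite ik (ltnW ik); exact: cS.
Qed.

Lemma graph_adjacent_sym (G : stdigraph) (u v : vertex G) :
  graph_adjacent u v -> graph_adjacent v u.
Proof. by case=> e [uv|vu]; exists e; [right | left]. Qed.

Lemma edge_lipschitz_walk (R : realType) (G : stdigraph) (h : vertex G -> R)
    (u v : vertex G) (k : nat) :
  edge_lipschitz h -> walk u v k -> `|h u - h v| <= k%:R.
Proof.
move=> hL [w [<- <- wS]].
have adj x y : graph_adjacent x y -> `|h x - h y| <= 1.
  by case=> e [[<- <-]|[<- <-]]; rewrite ?hL // distrC hL.
elim: k wS => [|k IH] wS; first by rewrite subrr normr0.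
rewrite (le_trans (ler_distD (h (w k)) _ _)) // -natr1 lerD //.
  by apply: IH => i ik; apply: wS; exact: ltnW.
by apply: adj; exact: wS.
Qed.

Lemma edge_lipschitz_graph_dist (R : realType) (G : stdigraph)
    (h : vertex G -> R) (u v : vertex G) :
  edge_lipschitz h -> joined u v -> `|h u - h v| <= graph_dist R u v.
Proof.
move=> hL [k uvk]; apply: lb_le_inf; first by exists k%:R, k.
by move=> _ [l uvl <-]; exact: edge_lipschitz_walk.
Qed.

Lemma graph_dist_edge (R : realType) (G : stdigraph) (e : edge G) :
  graph_dist R (src e) (tgt e) <= 1.
Proof.
apply: ge_inf; first by exists 0 => _ [k _ <-].
exists 1%N => //; exists (fun i => if i is 0%N then src e else tgt e).
by split=> // -[|//] _; exists e; left.
Qed.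

(** * Replacing every edge by a diamond *)

Definition old_vertex (G : stdigraph) (v : vertex G) :
  vertex (slash G diamond1) := inl v.

Definition midpoint (G : stdigraph) (e : edge G) (i : nat) :
  vertex (slash G diamond1) := slash_copy e (inr i : vertex diamond1).

Definition half_edge (G : stdigraph) (e : edge G) (i : nat) (b : bool) :
  edge (slash G diamond1) := (e, (i, b)).

Lemma src_half_edge (G : stdigraph) (e : edge G) i b :
  src (half_edge e i b) = if b then midpoint e i else old_vertex (src e).
Proof.
by case: b => //=; rewrite /slash_copy insubF.
Qed.

Lemma tgt_half_edge (G : stdigraph) (e : edge G) i b :
  tgt (half_edge e i b) = if b then old_vertex (tgt e) else midpoint e i.
Proof.
by case: b => //=; rewrite /slash_copy insubF.
Qed.

Lemma slash_edgeP (G : stdigraph) (f : edge (slash G diamond1)) :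
  exists e i b, f = half_edge e i b.
Proof. by case: f => e [i b]; exists e, i, b. Qed.

Lemma midpoint_inr (G : stdigraph) (e : edge G) (i : nat) :
  exists2 w : inner_vertex diamond1,
    midpoint e i = inr (e, w) & val w = inr i.
Proof.
rewrite /midpoint /slash_copy; case: insubP => [w _ wi|//].
by exists w.
Qed.


Lemma midpoint_inj (G : stdigraph) (e : edge G) : injective (midpoint e).
Proof.
move=> i j; have [v -> vi] := midpoint_inr e i.
by have [w -> wj] := midpoint_inr e j; case=> vw; move: vi; rewrite vw wj => -[].
Qed.

Lemma old_vertex_neq_midpoint (G : stdigraph) (v : vertex G) (e : edge G) i :
  (old_vertex v == midpoint e i) = false.
Proof. by have [w ->] := midpoint_inr e i. Qed.

Lemma src_midpoint_adjacent (G : stdigraph) (e : edge G) i :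
  graph_adjacent (old_vertex (src e)) (midpoint e i).
Proof.
by exists (half_edge e i false); left; rewrite src_half_edge tgt_half_edge.
Qed.

Lemma midpoint_tgt_adjacent (G : stdigraph) (e : edge G) i :
  graph_adjacent (midpoint e i) (old_vertex (tgt e)).
Proof.
by exists (half_edge e i true); left; rewrite src_half_edge tgt_half_edge.
Qed.

Lemma joined_midpoints (G : stdigraph) (e : edge G) i j :
  joined (midpoint e i) (midpoint e j).
Proof.
apply: joined_adjacent (src_midpoint_adjacent e j).
apply: joined_adjacent (graph_adjacent_sym (src_midpoint_adjacent e i)).
exact: joined_refl.
Qed.

Lemma joined_old_vertex (G : stdigraph) (u v : vertex G) :
  joined u v -> joined (old_vertex u) (old_vertex v).
Proof.
move=> [k [w [<- <- wS]]].
elim: k wS => [|k IH] wS; first exact: joined_refl.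
have {}IH : joined (old_vertex (w 0%N)) (old_vertex (w k)).
  by apply: IH => i ik; apply: wS; exact: ltnW.
have [e [[es et]|[es et]]] := wS k (ltnSn k).
- rewrite -et; apply: joined_adjacent (midpoint_tgt_adjacent e 0).
  by apply: joined_adjacent (src_midpoint_adjacent e 0); rewrite es.
- rewrite -es.
  apply: joined_adjacent (graph_adjacent_sym (src_midpoint_adjacent e 0)).
  apply: joined_adjacent (graph_adjacent_sym (midpoint_tgt_adjacent e 0)).
  by rewrite et.
Qed.

Definition slash_lift (R : realType) (G : stdigraph) (h : vertex G -> R)
    (v : vertex (slash G diamond1)) : R :=
  match v with
  | inl u => 2 * h u
  | inr (e, _) => h (src e) + h (tgt e)
  end.

(** Halfway along an edge, the mean of the doubled values at its ends is
    within 1 of both. *)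
Lemma slash_lift_lipschitz (R : realType) (G : stdigraph) (h : vertex G -> R) :
  edge_lipschitz h -> edge_lipschitz (slash_lift h).
Proof.
move=> hL f; have [e [i [b ->]]] := slash_edgeP f.
rewrite src_half_edge tgt_half_edge; have [w -> _] := midpoint_inr e i.
have := hL e; rewrite !ler_norml => /andP[h1 h2].
by case: b => /=; apply/andP; split; lra.
Qed.

(** Certifies that distinct midpoints [x_i] and [x_j] of the same edge are
    2-apart: a vertex with value other than 1 has old, hence value 1,
    neighbours only. *)
Definition midpoint_separator (R : realType) (G : stdigraph) (e : edge G)
    (i j : nat) (v : vertex (slash G diamond1)) : R :=
  1 + (v == midpoint e i)%:R - (v == midpoint e j)%:R.

Lemma midpoint_separator_lipschitz (R : realType) (G : stdigraph) (e : edge G)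
    i j : edge_lipschitz (@midpoint_separator R G e i j).
Proof.
move=> f; have [e' [l [b ->]]] := slash_edgeP f.
rewrite src_half_edge tgt_half_edge /midpoint_separator ler_norml.
case: b; rewrite !old_vertex_neq_midpoint;
  by do 2 case: (_ == _) => /=; apply/andP; split; lra.
Qed.

Lemma midpoint_separator_gap (R : realType) (G : stdigraph) (e : edge G) i j :
  i != j ->
  `|midpoint_separator R e i j (midpoint e i)
    - midpoint_separator R e i j (midpoint e j)| = 2.
Proof.
move=> ij; rewrite /midpoint_separator !eqxx !(inj_eq (@midpoint_inj _ e)).
by rewrite (negbTE ij) eq_sym (negbTE ij) /= ger0_norm; lra.
Qed.

(** * The contraction of the stretch *)

Lemma diamond_inequality_bound (R : realType) (X : metricType R) (p CD : R)
    (s t : X) (x : nat -> X) (b M : R) :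
  diamond_inequality X p CD ->
  (forall i j, i != j -> b <= mdist (x i) (x j) `^ p) ->
  (forall i, mdist s (x i) `^ p <= M) ->
  (forall i, mdist t (x i) `^ p <= M) ->
  mdist s t `^ p / 2 `^ p + b / CD `^ p <= M.
Proof.
move=> hX hb hs ht; rewrite -lee_fin EFinD.
apply: (le_trans (leeD2l _ _) (le_trans (hX s t x) _)).
  rewrite EFinM lee_wpmul2r ?lee_fin ?invr_ge0 ?powR_ge0//.
  apply: le_ereal_inf_tmp => _ [[i j] /= /eqP ij <-].
  by rewrite lee_fin hb.
by rewrite ge_max; apply/andP; split; apply: ge_ereal_sup => _ [i _ <-];
  rewrite lee_fin.
Qed.

(** By induction on [n], restricting [f] to the old vertices.  The lower
    Lipschitz condition is phrased with [edge_lipschitz] functions in place of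
    the graph distance, so that it passes to the restriction, with the constant
    doubled, by lifting these functions. *)
Lemma diamond_edge_image_bound (R : realType) (X : metricType R) (p CD : R)
    (n : nat) (f : vertex (diamond n) -> X) (a M : R) :
  0 <= p -> 0 < CD -> 0 < a -> diamond_inequality X p CD ->
  (forall (h : vertex (diamond n) -> R) u v, edge_lipschitz h -> joined u v ->
     a * `|h u - h v| <= mdist (f u) (f v)) ->
  (forall e : edge (diamond n), mdist (f (src e)) (f (tgt e)) `^ p <= M) ->
  n%:R * (2 * a / CD) `^ p <= M.
Proof.
move=> p0 CD0 + hX; elim: n f a M => [|n IH] f a M a0 fge fle.
  by rewrite mul0r (le_trans (powR_ge0 _ _) (fle tt)).
have pow20 : 0 < 2 `^ p :> R by exact: powR_gt0.
have restrict_le : (n%:R * (2 * (2 * a) / CD) `^ p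
    <= 2 `^ p * (M - (2 * a / CD) `^ p)).
  apply: (IH (f \o @old_vertex _)); first by rewrite mulr_gt0.
    move=> h u v hL uv /=; rewrite (le_trans _ (fge (slash_lift h) _ _ _ _))//.
    - by rewrite /= -mulrBr normrM ger0_norm// mulrA (mulrC a).
    - exact: slash_lift_lipschitz.
    - exact: joined_old_vertex.
  move=> e /=.
  have half i b := fle (half_edge e i b).
  have src_le i : mdist (f (old_vertex (src e))) (f (midpoint e i)) `^ p <= M.
    by have := half i false; rewrite src_half_edge tgt_half_edge.
  have tgt_le i : mdist (f (old_vertex (tgt e))) (f (midpoint e i)) `^ p <= M.
    by have := half i true; rewrite src_half_edge tgt_half_edge metric_sym.
  have sep i j : i != j ->
      (2 * a) `^ p <= mdist (f (midpoint e i)) (f (midpoint e j)) `^ p.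
    move=> ij; have := fge _ _ _ (@midpoint_separator_lipschitz R _ e i j)
      (joined_midpoints e i j).
    rewrite midpoint_separator_gap// mulrC => le_d.
    by rewrite ge0_ler_powR ?nnegrE ?mdist_ge0 ?mulr_ge0// ltW.
  have := diamond_inequality_bound hX sep src_le tgt_le.
  have -> : (2 * a) `^ p / CD `^ p = (2 * a / CD) `^ p.
    have ratio_ge0 : 0 <= 2 * a / CD by rewrite divr_ge0 ?mulr_ge0// ltW.
    have := powRM p ratio_ge0 (ltW CD0); rewrite divfK ?gt_eqF// => ->.
    by rewrite mulfK// gt_eqF// powR_gt0.
  by rewrite -lerBrDr ler_pdivrMr// mulrC.
move: restrict_le; rewrite -mulrA (powRM _ (ler0n _ 2)); last first.
  by rewrite divr_ge0 ?mulr_ge0// ltW.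
by rewrite mulrCA ler_pM2l// -[n.+1%:R]natr1 (mulrDl n%:R) mul1r lerBrDr.
Qed.

Theorem theorem3p7 (R : realType) (p CD : R) (hp : 1 <= p) (hCD : 0 < CD) :
  exists2 C : R, 0 < C &
    forall X : metricType R, diamond_inequality X p CD ->
    \forall n \near \oo, forall f : vertex (diamond n) -> X,
      bilipschitz (@graph_dist R (diamond n)) (@mdist R X) f ->
      C * n%:R `^ p^-1 <=
        distortion (@graph_dist R (diamond n)) (@mdist R X) f.
Proof.
exists (2 / CD) => [|X hX]; first exact: divr_gt0.
near=> n => f [K0 hK0]; apply: lb_le_inf; first by exists K0.
move=> K [K1 [a a0 fK]].
have p0 : 0 < p by exact: lt_le_trans hp.
have K_ge0 : 0 <= K by exact: le_trans K1.
have : n%:R * (2 * a / CD) `^ p <= (K * a) `^ p.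
  apply: (diamond_edge_image_bound (ltW p0) hCD a0 hX) => [h u v hL uv|e].
    have /andP[+ _] := fK u v; apply: le_trans.
    by rewrite ler_pM2l//; exact: edge_lipschitz_graph_dist.
  rewrite ge0_ler_powR ?nnegrE ?mdist_ge0 ?(ltW p0) ?mulr_ge0 ?(ltW a0)//.
  have /andP[_ /le_trans] := fK (src e) (tgt e); apply.
  by rewrite ler_piMr ?graph_dist_edge// mulr_ge0// ltW.
rewrite mulrAC powRM ?divr_ge0 ?(ltW a0) ?(ltW hCD)// (powRM _ K_ge0) ?(ltW a0)//.
rewrite mulrA ler_pM2r ?powR_gt0// => nK.
have : (n%:R * (2 / CD) `^ p) `^ p^-1 <= (K `^ p) `^ p^-1.
  by rewrite ge0_ler_powR ?nnegrE ?mulr_ge0 ?invr_ge0 ?powR_ge0 ?(ltW p0).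
rewrite powRM ?powR_ge0// -!powRrM divff ?gt_eqF// !powRr1// ?divr_ge0 ?(ltW hCD)//.
by rewrite mulrC.
Unshelve. all: by end_near.
Qed.
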